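(* Let $A=\Bbbk[x_1,\dots,x_n]$ and let $G=\{\sigma_1,\dots,\sigma_g\}\subseteq\operatorname{GL}_n(\Bbbk)$ be a finite group (with $g=|G|$) generated by reflections, acting on $A$ as automorphisms. Let $\{z_1,\dots,z_g\}$ be a basis of $A$ as an $A^G$-module, let $W=(\operatorname{tr}(z_iz_j))_{i,j}$ be the matrix of the trace form of the extension $A/A^G$ with respect to this basis, and let $M$ be the matrix $(\sigma_i(z_j))_{i,j}$. Then $W=M^TM$. As a consequence, $d(A/A^G)=(\det M)^2$ (up to a unit of $A^G$).
   Context: $\Bbbk$ is an algebraically closed field of characteristic zero. $G\subseteq\operatorname{GL}_n(\Bbbk)$ acts on the space of linear forms of $A$ and hence on $A$ by graded automorphisms; $A^G$ is the invariant ring. An element of $\operatorname{GL}_n(\Bbbk)$ is a reflection if it has finite order and fixes a codimension one subspace of the space of linear forms. By the Shephard–Todd–Chevalley theorem $A^G$ is a polynomial ring and $A$ is free over $A^G$ of rank $|G|$. Here $\operatorname{tr}:A\to A^G$ sends $f$ to the trace of the $A^G$-linear map $A\to A$ given by multiplication by $f$. The discriminant $d(A/A^G)$ is $\det(\operatorname{tr}(z_iz_j))$ for any $A^G$-basis $\{z_i\}$ of $A$; it is well defined up to multiplication by units of $A^G$. *)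

(* Defs.v *)
From HB Require Import structures.
From mathcomp Require Import all_boot all_order all_algebra.
From mathcomp Require Import mpoly.
From Stdlib Require Import ClassicalEpsilon.

Set Implicit Arguments.
Unset Strict Implicit.
Unset Printing Implicit Defensive.

Import GRing.Theory.
Local Open Scope ring_scope.

(* s is the matrix, in the basis 'X_0, ..., 'X_(n-1) of the linear forms, of an
   endomorphism acting on the left: 'X_j is sent to \sum_i s_ij 'X_i, so that
   mpoly_act (s *m t) f = mpoly_act s (mpoly_act t f). *)
Definition mpoly_act (k : fieldType) (n : nat) (s : 'M[k]_n)
    (f : {mpoly k[n]}) : {mpoly k[n]} :=
  f \mPo [tuple \sum_(i < n) s i j *: 'X_i | j < n].

HB.instance Definition _ (k : fieldType) (n : nat) (s : 'M[k]_n) :=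
  GRing.RMorphism.copy (mpoly_act s)
    (comp_mpoly [tuple \sum_(i < n) s i j *: 'X_i | j < n]).

Section Reflections.
Variables (k : fieldType) (n : nat).
Implicit Types (s t : 'M[k]_n) (G : seq 'M[k]_n).

Definition linform (c : 'rV[k]_n) : {mpoly k[n]} := \sum_(i < n) c 0 i *: 'X_i.

Definition finite_order s : Prop := exists2 m, (0 < m)%N & s ^+ m = 1.

(* The row space of U is the space of coefficient vectors of the linear forms in
   the fixed subspace; that subspace has dimension \rank U. *)
Definition fixes_codim1_subspace s : Prop :=
  exists U : 'M[k]_n, (\rank U).+1 = n /\
    forall c : 'rV_n, (c <= U)%MS -> mpoly_act s (linform c) = linform c.

Definition reflection s : Prop :=
  [/\ s \in unitmx, finite_order s & fixes_codim1_subspace s].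

Inductive generated (S : 'M[k]_n -> Prop) : 'M[k]_n -> Prop :=
| generated_mem s : S s -> generated S s
| generated_1 : generated S 1%:M
| generated_mul s t : generated S s -> generated S t -> generated S (s *m t)
| generated_inv s : generated S s -> generated S (invmx s).

Record is_GLsubgroup G : Prop := IsGLSubgroup {
  GLsubgroup_unit : {in G, forall s, s \in unitmx};
  GLsubgroup_1 : 1%:M \in G;
  GLsubgroup_mul : {in G &, forall s t, s *m t \in G};
  GLsubgroup_inv : {in G, forall s, invmx s \in G}
}.

Definition generated_by_reflections G : Prop :=
  exists S : 'M[k]_n -> Prop, (forall s, S s -> reflection s) /\
    forall s, s \in G <-> generated S s.

End Reflections.

(* A type alias: {mpoly k[n]} is canonically an algebra over k, its alias
   mpoly_over G is one over the ring of G-invariants. *)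
Definition mpoly_over (k : fieldType) (n : nat) (G : seq 'M[k]_n) : Type :=
  {mpoly k[n]}.

HB.instance Definition _ (k : fieldType) (n : nat) (G : seq 'M[k]_n) :=
  GRing.IntegralDomain.on (mpoly_over G).

Section Invariants.
Variables (k : fieldType) (n : nat) (G : seq 'M[k]_n).

Definition invariant : {pred {mpoly k[n]}} :=
  fun f => all (fun s => mpoly_act s f == f) G.

Lemma invariantP f :
  reflect {in G, forall s, mpoly_act s f = f} (f \in invariant).
Proof.
by apply: (iffP allP) => H s /H => [/eqP|->].
Qed.

Fact invariant_divring_closed : divring_closed invariant.
Proof.
split=> [|f h /invariantP fi /invariantP hi|f h /invariantP fi /invariantP hi];
  apply/invariantP => s sG.
- by rewrite rmorph1.
- by rewrite rmorphB /= fi ?hi.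
rewrite rmorphM /= fi //; congr (_ * _).
have [hU|hU] := boolP (h \is a GRing.unit); first by rewrite rmorphV //= hi.
by rewrite invr_out // hi.
Qed.

HB.instance Definition _ :=
  GRing.isDivringClosed.Build {mpoly k[n]} invariant invariant_divring_closed.

Record invariant_ring := InvariantRing {
  invariant_val :> {mpoly k[n]};
  _ : invariant_val \in invariant
}.

HB.instance Definition _ := [isSub for invariant_val].
HB.instance Definition _ := [Choice of invariant_ring by <:].
HB.instance Definition _ := [SubChoice_isSubIntegralDomain of invariant_ring by <:].

Definition mpoly_over_scale (a : invariant_ring) (f : mpoly_over G) : mpoly_over G :=
  (val a : mpoly_over G) * f.

Fact mpoly_over_scaleA a b f :
  mpoly_over_scale a (mpoly_over_scale b f) = mpoly_over_scale (a * b) f.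
Proof. by rewrite /mpoly_over_scale rmorphM /= mulrA. Qed.

Fact mpoly_over_scale1 : left_id 1 mpoly_over_scale.
Proof. by move=> f; rewrite /mpoly_over_scale rmorph1 mul1r. Qed.

Fact mpoly_over_scaleDr : right_distributive mpoly_over_scale +%R.
Proof. by move=> a f h; rewrite /mpoly_over_scale mulrDr. Qed.

Fact mpoly_over_scaleDl f : {morph mpoly_over_scale^~ f : a b / a + b}.
Proof. by move=> a b; rewrite /mpoly_over_scale rmorphD /= mulrDl. Qed.

HB.instance Definition _ :=
  GRing.Zmodule_isLmodule.Build invariant_ring (mpoly_over G)
    mpoly_over_scaleA mpoly_over_scale1 mpoly_over_scaleDr mpoly_over_scaleDl.

Fact mpoly_over_scaleAl (a : invariant_ring) (f h : mpoly_over G) :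
  a *: (f * h) = (a *: f) * h.
Proof. exact: mulrA. Qed.

HB.instance Definition _ :=
  GRing.Lmodule_isLalgebra.Build invariant_ring (mpoly_over G) mpoly_over_scaleAl.
HB.instance Definition _ :=
  GRing.Lalgebra_isComAlgebra.Build invariant_ring (mpoly_over G).

End Invariants.

Section FreeModules.
Variables (R : comNzRingType) (V : lmodType R).

Definition is_basis (m : nat) (b : 'I_m -> V) : Prop :=
  (forall v, exists c : 'I_m -> R, v = \sum_i c i *: b i) /\
  (forall c : 'I_m -> R, \sum_i c i *: b i = 0 -> forall i, c i = 0).

Definition is_trace (phi : V -> V) (t : R) : Prop :=
  exists (m : nat) (b : 'I_m -> V) (B : 'M[R]_m),
    [/\ is_basis b, forall j, phi (b j) = \sum_i B i j *: b i & t = \tr B].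

(* Meant for R-linear phi and V free of finite rank: the basis used to compute
   the trace is then immaterial. Otherwise the value may be junk. *)
Definition module_trace (phi : V -> V) : R :=
  epsilon (inhabits 0) (is_trace phi).

End FreeModules.

Section TraceForm.
Variables (R : comNzRingType) (A : comAlgType R).

Definition alg_trace (f : A) : R := module_trace (fun x : A => f * x).

Definition trace_form_mx (m : nat) (z : 'I_m -> A) : 'M[R]_m :=
  \matrix_(i, j) alg_trace (z i * z j).

(* d is a representative of the discriminant d(A/R), an element of R defined
   only up to a unit: it is computed from some basis. *)
Definition is_discriminant (d : R) : Prop :=
  exists (m : nat) (z : 'I_m -> A), is_basis z /\ d = \det (trace_form_mx z).

End TraceForm.
Arguments is_discriminant {R} A d.

(* Main.v *)
Require Import Defs.
From mathcomp Require Import all_boot all_order all_algebra.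
From mathcomp Require Import mpoly.
From Stdlib Require Import ClassicalEpsilon.

Set Implicit Arguments.
Unset Strict Implicit.
Unset Printing Implicit Defensive.

Import GRing.Theory.
Local Open Scope ring_scope.

(** Let B be the matrix of multiplication by f in the basis z.  Applying the
    automorphisms sigma_i to f z_j = \sum_l B_lj z_l gives D M = M B, where D is
    diagonal with entries sigma_i(f).  By Dedekind's independence of characters
    \det M != 0, so B and D have the same trace: tr(f) = \sum_i sigma_i(f),
    and W = M^T M is read off entrywise.  Changing the basis by an invertible
    matrix P with invariant entries replaces M by M P. *)

(** Artin's induction: subtracting [s m x] times the relation at [y] from the relation at [x * y]
    cancels the term of [m]. The shorter relation kills each [v i * (s i x - s m x)], so [v i != 0]
    would force [s i =1 s m]. *)
Lemma rmorphism_independent (A : nzRingType) (S : idomainType) (I : eqType)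
    (s : I -> {rmorphism A -> S}) (s_inj : forall i j, s i =1 s j -> i = j)
    (r : seq I) (v : I -> S) :
    uniq r -> (forall x, \sum_(i <- r) v i * s i x = 0) ->
  {in r, forall i, v i = 0}.
Proof.
elim: r v => [//|m r IHr] v /= /andP[m_r r_uniq] v0.
have vr0 : {in r, forall i, v i = 0}.
  move=> i i_r; apply/eqP/negP => /negP vi_neq0.
  suff /s_inj eq_im : s i =1 s m by rewrite -eq_im i_r in m_r.
  move=> x; apply/eqP; rewrite -subr_eq0.
  suff /eqP : v i * (s i x - s m x) = 0 by rewrite mulf_eq0 (negPf vi_neq0).
  apply: (IHr (fun j => v j * (s j x - s m x))) => // y.
  transitivity (\sum_(j <- m :: r) v j * s j (x * y)
                - s m x * \sum_(j <- m :: r) v j * s j y); last first.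
    by rewrite !v0 mulr0 subr0.
  rewrite mulr_sumr -sumrB big_cons rmorphM mulrCA subrr add0r.
  apply: eq_bigr => j _.
  by rewrite rmorphM mulrBr mulrBl -!mulrA [s m x * (v j * _)]mulrCA.
move=> i; rewrite inE => /predU1P[->|/vr0//].
have := v0 1; rewrite big_cons rmorph1 mulr1 big_seq big1 ?addr0 // => j /vr0->.
by rewrite mul0r.
Qed.

Section Bases.
Variables (R : comNzRingType) (V : lmodType R).

Lemma is_basis_coords (m m' : nat) (b : 'I_m -> V) (c : 'I_m' -> V) :
  is_basis b -> exists P : 'M[R]_(m, m'), forall j, c j = \sum_i P i j *: b i.
Proof.
case=> b_span _; have [p cE] := fin_all_exists (fun j => b_span (c j)).
exists (\matrix_(i, j) p j i) => j; rewrite cE.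
by apply: eq_bigr => i _; rewrite mxE.
Qed.

Lemma is_basis_coords_inj (m m' : nat) (b : 'I_m -> V) (P Q : 'M[R]_(m, m')) :
    is_basis b ->
    (forall j, \sum_i P i j *: b i = \sum_i Q i j *: b i) ->
  P = Q.
Proof.
case=> _ b_free PQ; apply/matrixP => i j; apply/eqP; rewrite -subr_eq0; apply/eqP.
apply: (b_free (fun i => P i j - Q i j)).
under eq_bigr do rewrite scalerBl.
by rewrite sumrB PQ subrr.
Qed.

Lemma coords_mul (m p q : nat) (b : 'I_m -> V) (c : 'I_p -> V) (d : 'I_q -> V)
    (P : 'M[R]_(m, p)) (Q : 'M[R]_(p, q)) :
    (forall j, c j = \sum_i P i j *: b i) ->
    (forall j, d j = \sum_i Q i j *: c i) ->
  forall j, d j = \sum_i (P *m Q) i j *: b i.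
Proof.
move=> cE dE j; rewrite dE.
under eq_bigr do rewrite cE scaler_sumr.
rewrite exchange_big; apply: eq_bigr => i _.
rewrite mxE scaler_suml; apply: eq_bigr => l _.
by rewrite scalerA mulrC.
Qed.

Lemma is_basis_change (m p : nat) (b : 'I_m -> V) (c : 'I_p -> V)
    (P : 'M[R]_(m, p)) (Q : 'M[R]_(p, m)) :
    is_basis b ->
    (forall j, c j = \sum_i P i j *: b i) ->
    (forall j, b j = \sum_i Q i j *: c i) ->
  P *m Q = 1%:M.
Proof.
move=> b_basis cE bE; apply: (is_basis_coords_inj b_basis) => j.
rewrite -(coords_mul cE bE) (bigD1 j) //= mxE eqxx scale1r big1 ?addr0 // => i.
by move=> /negPf ij; rewrite mxE ij scale0r.
Qed.

(** Both [B *m P] and [P *m C] hold the coordinates of the [phi (c j)] in [b]. As [P] and [Q] are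
    mutually inverse, the trace of [B] is that of [Q *m B *m P = C]. *)
Lemma is_trace_unique (phi : {linear V -> V}) (t u : R) :
  is_trace phi t -> is_trace phi u -> t = u.
Proof.
move=> [m [b [B [b_basis phib ->]]]] [p [c [C [c_basis phic ->]]]].
have [P cE] := is_basis_coords c b_basis; have [Q bE] := is_basis_coords b c_basis.
have QP := is_basis_change c_basis bE cE.
suff /(congr1 (mulmx Q)) : B *m P = P *m C.
  rewrite [in RHS]mulmxA QP mul1mx => <-.
  by rewrite mxtrace_mulC -mulmxA (is_basis_change b_basis cE bE) mulmx1.
apply: (is_basis_coords_inj b_basis) => j.
rewrite -(coords_mul phib (d := fun j => phi (c j))) => [|l]; last first.
  by rewrite cE linear_sum; apply: eq_bigr => i _; rewrite linearZ.
by rewrite -(coords_mul cE (d := fun j => phi (c j))).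
Qed.

Lemma module_trace_eq (phi : {linear V -> V}) (m : nat) (b : 'I_m -> V)
    (B : 'M[R]_m) :
    is_basis b -> (forall j, phi (b j) = \sum_i B i j *: b i) ->
  module_trace phi = \tr B.
Proof.
move=> b_basis phib; have B_trace : is_trace phi (\tr B) by exists m, b, B.
apply: (is_trace_unique (phi := phi)) => //.
by apply: epsilon_spec; exists (\tr B).
Qed.

End Bases.

(** The entry [s i j] is the coefficient of ['X_i] in the image of ['X_j]. Thus distinct matrices
    give distinct morphisms, as Dedekind's lemma requires. *)
Lemma mpoly_act_inj (k : fieldType) (n : nat) (s t : 'M[k]_n) :
  mpoly_act s =1 mpoly_act t -> s = t.
Proof.
move=> st; apply/matrixP => i j.
have := congr1 (mcoeff U_(i)) (st 'X_j).
rewrite /mpoly_act !comp_mpolyXU -!tnth_nth !tnth_mktuple !raddf_sum /=.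
under eq_bigr do rewrite mcoeffZ mcoeffX.
under [RHS]eq_bigr do rewrite mcoeffZ mcoeffX.
rewrite (bigD1 i) //= [RHS](bigD1 i) //= eqxx !mulr1.
rewrite !big1 ?addr0 // => l /negPf li; by rewrite eq_mnm1 li mulr0.
Qed.

Section OrbitMatrix.
Variables (k : fieldType) (n g : nat) (sigma : g.-tuple 'M[k]_n).
Hypothesis sigma_uniq : uniq sigma.

(** The family may have any length [m], so that a second basis can be treated before its length is
    known to be [g]. *)
Definition orbit_mx (m : nat) (z : 'I_m -> mpoly_over sigma) :
    'M[{mpoly k[n]}]_(g, m) :=
  \matrix_(i, j) mpoly_act (tnth sigma i) (z j).

(** Group elements fix invariant coefficients. These are put on the right to match a product with
    [orbit_mx] as left factor. *)
Lemma mpoly_act_lincomb (m : nat) (z : 'I_m -> mpoly_over sigma)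
    (c : 'I_m -> invariant_ring sigma) (i : 'I_g) :
  mpoly_act (tnth sigma i) (\sum_j c j *: z j)
  = \sum_j mpoly_act (tnth sigma i) (z j) * val (c j).
Proof.
rewrite rmorph_sum; apply: eq_bigr => j _.
rewrite [LHS](rmorphM (mpoly_act (tnth sigma i))) mulrC; congr (_ * _).
exact: (invariantP _ _ (valP (c j)) _ (mem_tnth _ _)).
Qed.

Lemma orbit_mx_coords (m p : nat) (b : 'I_m -> mpoly_over sigma)
    (c : 'I_p -> mpoly_over sigma) (P : 'M[invariant_ring sigma]_(m, p)) :
    (forall j, c j = \sum_i P i j *: b i) ->
  orbit_mx c = orbit_mx b *m map_mx val P.
Proof.
move=> cE; apply/matrixP => i j; rewrite !mxE cE mpoly_act_lincomb.
by apply: eq_bigr => l _; rewrite !mxE.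
Qed.

Variable z : 'I_g -> mpoly_over sigma.
Hypothesis z_basis : is_basis z.

(** A row vector [v] killed by the matrix gives a combination of the [sigma_i] that vanishes on the
    basis, hence on all polynomials by linearity over the invariants. Independence then forces
    [v = 0]. *)
Lemma det_orbit_mx_neq0 : \det (orbit_mx z) != 0.
Proof.
apply/det0P => -[v v_neq0 vM0]; case/negP: v_neq0; apply/eqP/rowP => i.
rewrite mxE; pose s j : {rmorphism _ -> _} := mpoly_act (tnth sigma j).
apply: (@rmorphism_independent _ _ _ s _ (index_enum 'I_g) (v 0));
  rewrite ?index_enum_uniq ?mem_index_enum //.
  by move=> j l /mpoly_act_inj/(tuple_uniqP _ sigma_uniq).
move=> f; have [c ->] := z_basis.1 f.
under eq_bigr do rewrite /s /= mpoly_act_lincomb mulr_sumr.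
rewrite exchange_big big1 // => l _.
under eq_bigr do rewrite mulrA.
rewrite -mulr_suml; have /rowP/(_ l) := vM0; rewrite !mxE.
by under eq_bigr do rewrite mxE; move->; rewrite mul0r.
Qed.

Lemma alg_trace_orbit_sum (f : mpoly_over sigma) :
  val (alg_trace f) = \sum_i mpoly_act (tnth sigma i) f.
Proof.
have [B fz] := is_basis_coords (fun j => f * z j) z_basis.
(* [f \*o idfun] is multiplication by [f], in a form that carries a linear structure. *)
rewrite /alg_trace (module_trace_eq (phi := f \*o idfun) z_basis fz).
pose D := diag_mx (\row_i mpoly_act (tnth sigma i) f).
have DM : D *m orbit_mx z = orbit_mx z *m map_mx val B.
  rewrite -(orbit_mx_coords fz); apply/matrixP => i j.
  by rewrite mul_diag_mx !mxE rmorphM.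
transitivity (\tr D); last by rewrite mxtrace_diag; apply: eq_bigr => i _; rewrite mxE.
(* M may fail to be invertible over the polynomials, so the adjugate replaces its inverse: det M tr
   B = tr(adj M M B) = tr(adj M D M) = tr(D M adj M) = det M tr D. *)
rewrite -trace_map_mx; apply: (mulfI det_orbit_mx_neq0).
rewrite -!mxtraceZ -!mul_scalar_mx -{1}mul_adj_mx -mulmxA -DM.
by rewrite mxtrace_mulC -mulmxA mul_mx_adj mxtrace_mulC.
Qed.

Lemma trace_form_orbit_mx (m : nat) (b : 'I_m -> mpoly_over sigma) :
  map_mx val (trace_form_mx b) = (orbit_mx b)^T *m orbit_mx b.
Proof.
apply/matrixP => i j; rewrite !mxE alg_trace_orbit_sum.
by apply: eq_bigr => l _; rewrite !mxE rmorphM.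
Qed.

Lemma discriminant_orbit_mx (d : invariant_ring sigma) :
    is_discriminant (mpoly_over sigma) d ->
  exists2 u : invariant_ring sigma, u \is a GRing.unit &
    val d = val u * (\det (orbit_mx z)) ^+ 2.
Proof.
move=> [m [b [b_basis ->]]].
have [P bE] := is_basis_coords b z_basis; have [Q zE] := is_basis_coords z b_basis.
have PQ := is_basis_change z_basis bE zE; have QP := is_basis_change b_basis zE bE.
(* One-sided inverses in both directions force the two bases to have equal length. *)
have eq_mg : m = g by apply/eqP; rewrite eqn_leq (mulmx1_min QP) (mulmx1_min PQ).
(* [P] is invertible over the invariant ring itself, so this is a unit there; it comes from the
   determinant of (M P)^T (M P). *)
subst m; exists (\det P ^+ 2).
  by rewrite unitrX // -unitmxE; have [] := mulmx1_unit PQ.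
rewrite -det_map_mx trace_form_orbit_mx (orbit_mx_coords bE).
by rewrite det_mulmx det_tr det_mulmx det_map_mx rmorphXn -expr2 exprMn mulrC.
Qed.

End OrbitMatrix.

Theorem proposition4p3 (k : closedFieldType) (k_char0 : [pchar k] =i pred0)
    (n g : nat) (sigma : g.-tuple 'M[k]_n) (sigma_uniq : uniq sigma)
    (G_group : is_GLsubgroup sigma)
    (G_refl : generated_by_reflections sigma)
    (z : 'I_g -> mpoly_over sigma) (z_basis : is_basis z) :
  let W : 'M[invariant_ring sigma]_g := trace_form_mx z in
  let M : 'M[{mpoly k[n]}]_g :=
    \matrix_(i, j) mpoly_act (tnth sigma i) (z j) in
  map_mx val W = M^T *m M /\
  (forall d : invariant_ring sigma, is_discriminant (mpoly_over sigma) d ->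
     exists2 u : invariant_ring sigma, u \is a GRing.unit &
       val d = val u * (\det M) ^+ 2).
Proof.
move=> W M; split; first exact: (trace_form_orbit_mx sigma_uniq z_basis).
by move=> d; apply: (discriminant_orbit_mx sigma_uniq z_basis).
Qed.
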